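(* Let $a=\sqrt{2\left(1-\sqrt{0.5}\right)}$, $b=\sqrt{2\left(1+\sqrt{0.5}\right)}$ and $\delta=\sqrt{b/a}$. For $\gamma\ge 0$ let $$\mathcal{H}_2(\gamma)=Q_1\left(a\sqrt{\gamma},b\sqrt{\gamma}\right)-\frac12 I_0\left(\sqrt2\,\gamma\right)e^{-2\gamma}$$ be the bit error probability of DQPSK modulation with Gray coding. Then for every $\gamma\ge 0$, $$\mathcal{H}_2(\gamma)\ \ge\ \mathcal{L}(\gamma):=\delta\,\mathcal{K}(a,b,\gamma)-\frac12 I_0\left(\sqrt2\,\gamma\right)e^{-2\gamma},$$ where $\mathcal{K}(a,b,\gamma)=Q\left((b-a)\sqrt{\gamma}\right)-Q\left((b+a)\sqrt{\gamma}\right)$.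
   Context: $\gamma$ is the signal-to-noise ratio per bit. $I_v$ denotes the modified Bessel function of the first kind of order $v$. $Q(x)=\frac{1}{\sqrt{2\pi}}\int_x^\infty e^{-t^2/2}\,dt$ is the Gaussian $Q$-function. $Q_1$ is the first-order Marcum $Q$-function, $Q_1(\alpha,\beta)=\int_\beta^\infty t\exp\left(-\frac{t^2+\alpha^2}{2}\right)I_0(\alpha t)\,dt$. *)

(* Defs.v *)
From Stdlib Require Import Reals Factorial.
From Coquelicot Require Import Coquelicot.
Open Scope R_scope.

(** The order is a natural number, so that Gamma (n + k + 1) = (n + k)! in the
    usual series
    I_n(x) = sum_k (x/2)^(2k+n) / (k! Gamma(n+k+1)). *)
Definition besselI (n : nat) (x : R) : R :=
  Series (fun k : nat => (x / 2) ^ (2 * k + n) / (INR (fact k) * INR (fact (n + k)))).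

Definition RInt_ray (f : R -> R) (x : R) : R :=
  RInt_gen f (at_point x) (Rbar_locally p_infty).

Definition gaussQ (x : R) : R :=
  1 / sqrt (2 * PI) * RInt_ray (fun t => exp (- t ^ 2 / 2)) x.

Definition marcumQ1 (alpha beta : R) : R :=
  RInt_ray (fun t => t * exp (- ((t ^ 2 + alpha ^ 2) / 2)) * besselI 0 (alpha * t)) beta.

Definition dqpsk_a : R := sqrt (2 * (1 - sqrt (1 / 2))).
Definition dqpsk_b : R := sqrt (2 * (1 + sqrt (1 / 2))).
Definition dqpsk_delta : R := sqrt (dqpsk_b / dqpsk_a).

Definition calK (a b gamma : R) : R :=
  gaussQ ((b - a) * sqrt gamma) - gaussQ ((b + a) * sqrt gamma).

(** Bit error probability of Gray-coded DQPSK at signal-to-noise ratio [gamma]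
    per bit. *)
Definition calH2 (gamma : R) : R :=
  marcumQ1 (dqpsk_a * sqrt gamma) (dqpsk_b * sqrt gamma)
  - 1 / 2 * besselI 0 (sqrt 2 * gamma) * exp (- (2 * gamma)).

Definition calL (gamma : R) : R :=
  dqpsk_delta * calK dqpsk_a dqpsk_b gamma
  - 1 / 2 * besselI 0 (sqrt 2 * gamma) * exp (- (2 * gamma)).

(* Main.v *)
(** Writing [Q (beta - alpha) - Q (beta + alpha)] as an integral over the ray
    [t >= beta], the claim follows from the pointwise comparison
    [t * I_0 (alpha t) >= sqrt (b / a) * sqrt (2 / PI) * sinh (alpha t)],
    that is from [I_0 >= I_{1/2}]. With [w_n = (2n)! / (4^n n!^2)], Vandermonde's
    identity gives [I_0(x)^2 = sum_n w_n^2 (2x)^(2n) / (2n)!]; Wallis' bound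
    [w_n^2 >= 2 / (PI * (2n + 1))] turns this into [I_0(x)^2 >= sinh(2x) / (PI x)],
    which exceeds [2 sinh(x)^2 / (PI x) = I_{1/2}(x)^2]. *)

Require Import Defs.
From Stdlib Require Import Reals Factorial Lra Lia.
From Coquelicot Require Import Coquelicot.
From mathcomp Require ssreflect ssrbool ssrnat bigop binomial fintype.
Open Scope R_scope.

(** * Vandermonde's identity for real binomial coefficients *)

Module Vandermonde.
Import ssreflect ssrbool ssrnat bigop binomial fintype.

Lemma fact_factorial (n : nat) : Factorial.fact n = factorial n.
Proof. elim: n => [//|n IH]; by rewrite factS -IH. Qed.

(** The bound on [k] matters: for [k > n] the natural binomial is 0, whereas [Binomial.C], with
    truncated subtraction, is n!/k!. *)
Lemma INR_binomial (n k : nat) :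
  (k <= n)%coq_nat -> INR (binomial n k) = Binomial.C n k.
Proof.
move=> /leP le_kn.
rewrite /Binomial.C !fact_factorial -(bin_fact le_kn) !mult_INR.
rewrite minusE; field; split; rewrite -fact_factorial; exact: INR_fact_neq_0.
Qed.

Lemma INR_sum (F : nat -> nat) (n : nat) :
  INR (\sum_(k < n.+1) F k) = sum_f_R0 (fun k => INR (F k)) n.
Proof.
elim: n => [|n IH]; first by rewrite big_ord_recr big_ord0.
by rewrite big_ord_recr plus_INR IH.
Qed.

Lemma sum_C_sqr (n : nat) :
  sum_f_R0 (fun k => Binomial.C n k * Binomial.C n (n - k)%coq_nat) n
  = Binomial.C (n + n) n.
Proof.
rewrite -INR_binomial; last by apply/leP; exact: leq_addr.
rewrite -Vandermonde (INR_sum (fun k => binomial n k * binomial n (n - k))%nat); apply: PartSum.sum_eq => k le_kn.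
by rewrite mult_INR !INR_binomial //; apply/leP; exact: leq_subr.
Qed.

End Vandermonde.

(** * Central binomial ratios and Wallis' integrals *)

Lemma INR_fact_gt0 (n : nat) : 0 < INR (fact n).
Proof. apply lt_0_INR, lt_O_fact. Qed.

Lemma INR_fact_S (n : nat) : INR (fact (S n)) = (INR n + 1) * INR (fact n).
Proof. rewrite fact_simpl, mult_INR, S_INR; reflexivity. Qed.

(** The w_n of the overview, that is, the central binomial coefficient of order 2n divided by
    4^n. *)
Definition central_ratio (n : nat) : R :=
  INR (fact (2 * n)) / (4 ^ n * INR (fact n) ^ 2).

Lemma central_ratio_gt0 (n : nat) : 0 < central_ratio n.
Proof.
  unfold central_ratio; apply Rdiv_lt_0_compat; [apply INR_fact_gt0|].
  apply Rmult_lt_0_compat; apply pow_lt; [lra | apply INR_fact_gt0].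
Qed.

Lemma central_ratio_S (n : nat) :
  central_ratio (S n) = (2 * INR n + 1) / (2 * INR n + 2) * central_ratio n.
Proof.
  unfold central_ratio.
  replace (2 * S n)%nat with (S (S (2 * n))) by lia.
  rewrite !INR_fact_S, S_INR, mult_INR, <- tech_pow_Rmult; change (INR 2) with 2.
  pose proof (INR_fact_gt0 n); pose proof (pos_INR n).
  assert (0 < 4 ^ n) by (apply pow_lt; lra).
  field; repeat split; lra.
Qed.

Lemma central_ratio_le1 (n : nat) : central_ratio n <= 1.
Proof.
  induction n as [|n IH].
  - unfold central_ratio; simpl; lra.
  - rewrite central_ratio_S; pose proof (pos_INR n).
    pose proof (central_ratio_gt0 n).
    assert ((2 * INR n + 1) / (2 * INR n + 2) <= 1)
      by (apply Rle_div_l; lra).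
    assert (0 <= (2 * INR n + 1) / (2 * INR n + 2))
      by (apply Rdiv_le_0_compat; lra).
    nra.
Qed.

Lemma continuous_ex_derive (f : R -> R) (x : R) : ex_derive f x -> continuous f x.
Proof. apply (ex_derive_continuous (V := R_NormedModule)). Qed.

Definition wallis_int (n : nat) : R := RInt (fun t => cos t ^ n) 0 (PI / 2).

Lemma ex_RInt_cos_pow (n : nat) (a b : R) : ex_RInt (fun t => cos t ^ n) a b.
Proof.
  apply (ex_RInt_continuous (V := R_CompleteNormedModule)); intros t _.
  apply continuous_ex_derive; auto_derive; exact I.
Qed.

(** The derivative of sin t cos^(n+1) t is (n+2) cos^(n+2) t - (n+1) cos^n t, and this primitive
    vanishes at 0 and at PI/2. *)
Lemma wallis_int_SS (n : nat) :
  (INR n + 2) * wallis_int (S (S n)) = (INR n + 1) * wallis_int n.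
Proof.
  apply Rminus_diag_uniq; unfold wallis_int.
  rewrite <- !(RInt_scal (V := R_CompleteNormedModule)) by apply ex_RInt_cos_pow.
  rewrite <- (RInt_minus (V := R_CompleteNormedModule))
    by (apply (ex_RInt_scal (V := R_NormedModule)), ex_RInt_cos_pow).
  apply is_RInt_unique.
  replace 0 with (minus (sin (PI / 2) * cos (PI / 2) ^ S n) (sin 0 * cos 0 ^ S n)) at 2.
  2: { rewrite cos_PI2, sin_0; unfold minus, plus, opp; simpl; ring. }
  apply (is_RInt_derive (fun t => sin t * cos t ^ S n)).
  - intros t _; auto_derive; [exact I|].
    change (pred (S n)) with n.
    change (match n with O => 1 | S _ => INR n + 1 end) with (INR (S n)).
    rewrite S_INR.
    match goal with |- _ = ?r => change r with
      ((INR n + 2) * (cos t * (cos t * cos t ^ n)) - (INR n + 1) * cos t ^ n) end.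
    simpl (cos t ^ S n).
    pose proof (sin2_cos2 t) as E; unfold Rsqr in E.
    transitivity (cos t * cos t * cos t ^ n - (INR n + 1) * (sin t * sin t) * cos t ^ n);
      [ring|].
    replace (sin t * sin t) with (1 - cos t * cos t) by lra.
    ring.
  - intros t _; apply (continuous_minus (V := R_NormedModule));
      apply (continuous_scal_r (V := R_NormedModule));
      apply continuous_ex_derive; auto_derive; exact I.
Qed.

(** The two-step recursion makes the left side independent of n; at n = 0 the two integrals are PI/2
    and 1. *)
Lemma wallis_int_prod (n : nat) :
  (INR n + 1) * (wallis_int n * wallis_int (S n)) = PI / 2.
Proof.
  induction n as [|n IH].
  - unfold wallis_int; simpl.
    rewrite (RInt_ext (fun t => cos t * 1) cos) by (intros; apply Rmult_1_r).
    rewrite (RInt_const (V := R_CompleteNormedModule)).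
    rewrite (is_RInt_unique cos 0 (PI / 2) (minus (sin (PI / 2)) (sin 0))).
    + rewrite sin_PI2, sin_0; unfold minus, plus, opp, scal; simpl.
      unfold mult; simpl; ring.
    + apply (is_RInt_derive sin); intros t _.
      * auto_derive; [exact I | ring].
      * apply continuous_ex_derive; auto_derive; exact I.
  - rewrite S_INR, <- IH; pose proof (wallis_int_SS n) as E.
    transitivity (wallis_int (S n) * ((INR n + 2) * wallis_int (S (S n)))); [ring|].
    rewrite E; ring.
Qed.

Lemma wallis_int_decr (n : nat) : wallis_int (S n) <= wallis_int n.
Proof.
  pose proof PI_RGT_0.
  apply RInt_le; [lra | apply ex_RInt_cos_pow | apply ex_RInt_cos_pow |].
  intros t Ht; simpl.
  assert (0 <= cos t) by (apply cos_ge_0; lra).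
  pose proof (COS_bound t); pose proof (pow_le (cos t) n ltac:(lra)).
  nra.
Qed.

Lemma wallis_int_even (n : nat) : wallis_int (2 * n) = PI / 2 * central_ratio n.
Proof.
  induction n as [|n IH].
  - unfold wallis_int, central_ratio; simpl.
    rewrite (RInt_const (V := R_CompleteNormedModule)).
    unfold scal; simpl; unfold mult; simpl; field.
  - replace (2 * S n)%nat with (S (S (2 * n))) by lia.
    pose proof (wallis_int_SS (2 * n)) as E; pose proof (pos_INR n).
    rewrite IH, mult_INR in E; change (INR 2) with 2 in E.
    rewrite central_ratio_S.
    apply (Rmult_eq_reg_l (2 * INR n + 2)); [|lra].
    rewrite E; field; lra.
Qed.

(** Write W_m for [wallis_int m]. Then (2n+1) W_(2n) W_(2n+1) = PI/2 and W_(2n+1) <= W_(2n) = (PI/2)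
    w_n, hence PI/2 <= (2n+1) (PI/2)^2 w_n^2. *)
Lemma central_ratio_wallis (n : nat) :
  2 <= PI * (2 * INR n + 1) * central_ratio n ^ 2.
Proof.
  pose proof (wallis_int_prod (2 * n)) as E.
  pose proof (wallis_int_decr (2 * n)) as D.
  pose proof (central_ratio_gt0 n); pose proof PI_RGT_0; pose proof (pos_INR n).
  rewrite mult_INR in E; change (INR 2) with 2 in E; rewrite wallis_int_even in E, D.
  set (w := central_ratio n) in *; set (v := wallis_int _) in *.
  assert ((2 * INR n + 1) * (PI / 2 * w * v)
          <= (2 * INR n + 1) * (PI / 2 * w * (PI / 2 * w))).
  { apply Rmult_le_compat_l; [lra|]; apply Rmult_le_compat_l; [nra | exact D]. }
  apply (Rmult_le_reg_l (PI / 4)); [lra|]. nra.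
Qed.

(** * I_0 and its square as power series in (x/2)^2 *)

Definition bessel0_coef (n : nat) : R := / INR (fact n) ^ 2.

Lemma besselI0_PSeries (x : R) : besselI 0 x = PSeries bessel0_coef ((x / 2) ^ 2).
Proof.
  apply Series_ext; intro k; unfold bessel0_coef.
  rewrite Nat.add_0_r, Nat.add_0_l, pow_mult.
  pose proof (INR_fact_gt0 k); field; lra.
Qed.

Lemma CV_radius_bessel0_coef : CV_radius bessel0_coef = p_infty.
Proof.
  apply CV_radius_infinite_DAlembert.
  - intro n; unfold bessel0_coef; apply Rinv_neq_0_compat, pow_nonzero.
    apply INR_fact_neq_0.
  - apply is_lim_seq_ext with (fun n => / INR (S n) * / INR (S n)).
    + intro n; pose proof (INR_fact_gt0 n); pose proof (pos_INR n).
      rewrite Rabs_pos_eq; unfold bessel0_coef; rewrite INR_fact_S, ?S_INR.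
      * field; split; lra.
      * apply Rdiv_le_0_compat; [|apply Rinv_0_lt_compat, pow_lt; lra].
        apply Rlt_le, Rinv_0_lt_compat, pow_lt; nra.
    + assert (L : is_lim_seq (fun n => / INR (S n)) 0).
      { apply (is_lim_seq_inv (fun n => INR (S n)) p_infty); [|discriminate].
        apply (is_lim_seq_incr_1 INR), is_lim_seq_INR. }
      replace (Finite 0) with (Finite (0 * 0)) by (f_equal; ring).
      apply is_lim_seq_mult'; exact L.
Qed.

Lemma in_bessel0_disk (y : R) : Rbar_lt (Rabs y) (CV_radius bessel0_coef).
Proof. rewrite CV_radius_bessel0_coef; exact I. Qed.

(** The Cauchy product sums 1/(k! (n-k)!)^2 = C(n,k)^2 / n!^2, so Vandermonde gives C(2n,n) / n!^2 =
    (2n)! / n!^4. The power 16^n cancels the two factors 4^n in w_n^2. *)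
Lemma PS_mult_bessel0_coef (n : nat) :
  PS_mult bessel0_coef bessel0_coef n
  = 16 ^ n * central_ratio n ^ 2 / INR (fact (2 * n)).
Proof.
  transitivity (/ INR (fact n) ^ 2 * Binomial.C (n + n) n).
  - rewrite <- Vandermonde.sum_C_sqr, scal_sum; apply PartSum.sum_eq; intros k Hk.
    rewrite <- (pascal_step1 n k) by exact Hk.
    unfold bessel0_coef, Binomial.C.
    pose proof (INR_fact_gt0 n); pose proof (INR_fact_gt0 k).
    pose proof (INR_fact_gt0 (n - k)); field; repeat split; lra.
  - unfold Binomial.C, central_ratio.
    replace (n + n - n)%nat with n by lia; replace (n + n)%nat with (2 * n)%nat by lia.
    replace 16 with (4 * 4) by ring; rewrite Rpow_mult_distr.
    pose proof (INR_fact_gt0 n); pose proof (INR_fact_gt0 (2 * n)).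
    assert (0 < 4 ^ n) by (apply pow_lt; lra).
    field; repeat split; lra.
Qed.

(** * Hyperbolic functions as power series in x^2 *)

Lemma ex_pseries_le_exp (a : nat -> R) (y : R) :
  (forall n, 0 <= a n <= / INR (fact n)) -> 0 <= y -> ex_pseries a y.
Proof.
  intros Ha Hy; apply ex_pseries_R.
  apply (ex_series_le (V := R_CompleteNormedModule) _ (fun n => / INR (fact n) * y ^ n)).
  - intro n; pose proof (pow_le y n Hy); specialize (Ha n).
    unfold norm; simpl; unfold abs; simpl.
    rewrite Rabs_pos_eq by nra; nra.
  - apply ex_pseries_R; exists (exp y); apply is_exp_Reals.
Qed.

Lemma inv_fact_le (m n : nat) : (m <= n)%nat -> 0 <= / INR (fact n) <= / INR (fact m).
Proof.
  intro H; split; [apply Rlt_le, Rinv_0_lt_compat, INR_fact_gt0|].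
  apply Rinv_le_contravar; [apply INR_fact_gt0|].
  apply le_INR, fact_le, H.
Qed.

Definition cosh_coef (n : nat) : R := / INR (fact (2 * n)).
(** Coefficients of sinh x / x in the variable x^2; removing the factor x leaves an even
    function. *)
Definition sinhc_coef (n : nat) : R := / INR (fact (2 * n + 1)).

Lemma ex_pseries_cosh (y : R) : 0 <= y -> ex_pseries cosh_coef y.
Proof. apply ex_pseries_le_exp; intro n; apply inv_fact_le; lia. Qed.

Lemma ex_pseries_sinhc (y : R) : 0 <= y -> ex_pseries sinhc_coef y.
Proof. apply ex_pseries_le_exp; intro n; apply inv_fact_le; lia. Qed.

Lemma exp_odd_even (x : R) :
  exp x = PSeries cosh_coef (x ^ 2) + x * PSeries sinhc_coef (x ^ 2).
Proof.
  rewrite exp_Reals; apply PSeries_odd_even;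
    [apply ex_pseries_cosh | apply ex_pseries_sinhc]; apply pow2_ge_0.
Qed.

Lemma cosh_PSeries (x : R) : cosh x = PSeries cosh_coef (x ^ 2).
Proof.
  unfold cosh; rewrite (exp_odd_even x), (exp_odd_even (- x)).
  replace ((- x) ^ 2) with (x ^ 2) by ring; field.
Qed.

Lemma sinh_PSeries (x : R) : sinh x = x * PSeries sinhc_coef (x ^ 2).
Proof.
  unfold sinh; rewrite (exp_odd_even x), (exp_odd_even (- x)).
  replace ((- x) ^ 2) with (x ^ 2) by ring; field.
Qed.

(** * Bounds for I_0 from above and below *)

Lemma besselI0_ge0 (x : R) : 0 <= besselI 0 x.
Proof.
  rewrite besselI0_PSeries; unfold PSeries.
  rewrite <- (Rmult_0_l (Series (fun _ => 0))), <- Series_scal_l.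
  apply Series_le.
  - intro n; rewrite Rmult_0_l; split; [lra|].
    apply Rmult_le_pos; [|apply pow_le, pow2_ge_0].
    apply Rlt_le, Rinv_0_lt_compat, pow_lt, INR_fact_gt0.
  - apply ex_pseries_R, CV_radius_inside, in_bessel0_disk.
Qed.

(** Termwise, the series of I_0 is that of cosh multiplied by w_n <= 1. This controls the growth of
    the Marcum integrand. *)
Lemma besselI0_le_cosh (x : R) : besselI 0 x <= cosh x.
Proof.
  rewrite besselI0_PSeries, cosh_PSeries; apply Series_le.
  - intro n.
    assert (E : bessel0_coef n * ((x / 2) ^ 2) ^ n
                = central_ratio n * (cosh_coef n * (x ^ 2) ^ n)).
    { replace ((x / 2) ^ 2) with (x ^ 2 * / 4) by field.
      rewrite Rpow_mult_distr, pow_inv; unfold bessel0_coef, central_ratio, cosh_coef.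
      pose proof (INR_fact_gt0 n); pose proof (INR_fact_gt0 (2 * n)).
      assert (0 < 4 ^ n) by (apply pow_lt; lra).
      field; repeat split; lra. }
    rewrite E.
    assert (0 <= cosh_coef n * (x ^ 2) ^ n).
    { apply Rmult_le_pos; [|apply pow_le, pow2_ge_0].
      apply Rlt_le, Rinv_0_lt_compat, INR_fact_gt0. }
    pose proof (central_ratio_gt0 n); pose proof (central_ratio_le1 n); nra.
  - apply ex_pseries_R, ex_pseries_cosh, pow2_ge_0.
Qed.

Lemma exp_le_exp (x y : R) : x <= y -> exp x <= exp y.
Proof. intros [H | ->]; [left; apply exp_increasing, H | right; reflexivity]. Qed.

Lemma besselI0_le_exp (x : R) : 0 <= x -> besselI 0 x <= exp x.
Proof.
  intro Hx; apply Rle_trans with (1 := besselI0_le_cosh x); unfold cosh.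
  assert (exp (- x) <= exp x) by (apply exp_le_exp; lra); lra.
Qed.

(** With y = (x/2)^2 one has (2x)^2 = 16y, so sinh(2x)/(2x) and I_0(x)^2 are both power series in y.
    PI times a term of the latter is PI (2n+1) w_n^2 times the matching term of the former, and
    Wallis' bound makes this factor at least 2. *)
Lemma sinh_double_le_besselI0_sqr (x : R) :
  0 <= x -> sinh (2 * x) <= PI * x * besselI 0 x ^ 2.
Proof.
  intro Hx; rewrite sinh_PSeries, besselI0_PSeries.
  pose proof PI_RGT_0.
  set (y := (x / 2) ^ 2).
  (* The claim with the common factor x removed, so that x = 0 needs no separate case. *)
  assert (S : 2 * PSeries sinhc_coef ((2 * x) ^ 2) <= PI * PSeries bessel0_coef y ^ 2).
  { replace (PSeries bessel0_coef y ^ 2)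
      with (PSeries bessel0_coef y * PSeries bessel0_coef y) by ring.
    rewrite <- PSeries_mult by apply in_bessel0_disk.
    unfold PSeries; rewrite <- !Series_scal_l; apply Series_le.
    - intro n; rewrite PS_mult_bessel0_coef.
      assert (E : PI * (16 ^ n * central_ratio n ^ 2 / INR (fact (2 * n)) * y ^ n)
              = PI * (2 * INR n + 1) * central_ratio n ^ 2
                * (sinhc_coef n * ((2 * x) ^ 2) ^ n)).
      { replace ((2 * x) ^ 2) with (16 * y) by (unfold y; field).
        rewrite Rpow_mult_distr; unfold sinhc_coef; rewrite Nat.add_1_r, INR_fact_S.
        rewrite mult_INR; change (INR 2) with 2.
        pose proof (INR_fact_gt0 (2 * n)); pose proof (pos_INR n).
        field; split; lra. }
      rewrite E.
      assert (0 <= sinhc_coef n * ((2 * x) ^ 2) ^ n).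
      { apply Rmult_le_pos; [|apply pow_le, pow2_ge_0].
        apply Rlt_le, Rinv_0_lt_compat, INR_fact_gt0. }
      pose proof (central_ratio_wallis n); split; [lra|].
      apply Rmult_le_compat_r; assumption.
    - apply (ex_series_scal_l (V := R_NormedModule) PI), ex_pseries_R, ex_pseries_mult; apply in_bessel0_disk. }
  nra.
Qed.

(* I_0 >= I_{1/2}, as I_{1/2}(x) = sqrt (2 / (PI * x)) * sinh x. *)
Lemma sinh_sqr_le_besselI0_sqr (x : R) :
  0 <= x -> 2 * sinh x ^ 2 <= PI * x * besselI 0 x ^ 2.
Proof.
  intro Hx; apply Rle_trans with (2 := sinh_double_le_besselI0_sqr x Hx).
  unfold sinh; replace (exp (2 * x)) with (exp x ^ 2)
    by (replace (2 * x) with (x + x) by ring; rewrite exp_plus; ring).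
  replace (exp (- (2 * x))) with (exp (- x) ^ 2)
    by (replace (- (2 * x)) with (- x + - x) by ring; rewrite exp_plus; ring).
  (* With v = exp(-x), the difference sinh(2x) - 2 sinh(x)^2 equals 1 - v^2, and v <= 1. *)
  assert (E : exp x * exp (- x) = 1) by (rewrite <- exp_plus, Rplus_opp_r; apply exp_0).
  assert (exp (- x) <= 1) by (rewrite <- exp_0; apply exp_le_exp; lra).
  pose proof (exp_pos (- x)); nra.
Qed.

Lemma continuous_besselI0 (x : R) : continuous (besselI 0) x.
Proof.
  apply (continuous_ext (fun x => PSeries bessel0_coef ((x / 2) ^ 2)));
    [intro; symmetry; apply besselI0_PSeries|].
  apply (continuous_comp (fun x => (x / 2) ^ 2) (PSeries bessel0_coef)).
  - apply continuous_ex_derive; auto_derive; exact I.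
  - apply continuity_pt_filterlim, PSeries_continuity, in_bessel0_disk.
Qed.

(** * Improper integrals over a ray as limits *)

Lemma ex_RInt_of_continuous (f : R -> R) (a b : R) :
  (forall t, continuous f t) -> ex_RInt f a b.
Proof. intro Hf; apply (ex_RInt_continuous (V := R_CompleteNormedModule)); auto. Qed.

Lemma RInt_ray_of_is_lim (f : R -> R) (a l : R) :
  (forall t, continuous f t) ->
  is_lim (fun X => RInt f a X) p_infty l -> RInt_ray f a = l.
Proof.
  intros Hf Hl; apply is_RInt_gen_unique.
  intros P HP; destruct (Hl P HP) as [M HM].
  apply (Filter_prod _ _ _ (fun x => x = a) (fun X => M < X)).
  - reflexivity.
  - exists M; auto.
  - intros x X -> HX; exists (RInt f a X); split; [|apply HM, HX].
    apply (RInt_correct (V := R_CompleteNormedModule)), ex_RInt_of_continuous, Hf.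
Qed.

Lemma RInt_exp_opp (c a b : R) :
  is_RInt (fun t => c * exp (- t)) a b (c * exp (- a) - c * exp (- b)).
Proof.
  replace (c * exp (- a) - c * exp (- b))
    with (minus (- c * exp (- b)) (- c * exp (- a)))
    by (unfold minus, plus, opp; simpl; ring).
  apply (is_RInt_derive (fun t => - c * exp (- t))); intros t _.
  - auto_derive; [exact I | ring].
  - apply continuous_ex_derive; auto_derive; exact I.
Qed.

(** Since f >= 0, the integral up to X increases with X; the exponential majorant bounds it by c
    exp(-a), so it converges to its supremum. This certifies that [RInt_ray f a] is a genuine
    limit. *)
Lemma is_lim_RInt_ray (f : R -> R) (a c : R) :
  (forall t, continuous f t) ->
  (forall t, a <= t -> 0 <= f t <= c * exp (- t)) ->
  is_lim (fun X => RInt f a X) p_infty (RInt_ray f a).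
Proof.
  intros Hf Hb.
  pose proof (fun u v => ex_RInt_of_continuous f u v Hf) as Hex.
  assert (Hincr : forall X Y, a <= X <= Y -> RInt f a X <= RInt f a Y).
  { intros X Y HXY.
    rewrite <- (RInt_Chasles f a X Y) by apply Hex.
    assert (0 <= RInt f X Y).
    { apply RInt_ge_0; [lra | apply Hex | intros t Ht; apply Hb; lra]. }
    unfold plus; simpl; lra. }
  assert (Hbound : forall X, a <= X -> RInt f a X <= c * exp (- a)).
  { intros X HX; pose proof (RInt_exp_opp c a X) as E.
    assert (0 <= c * exp (- X)) by (destruct (Hb X HX); lra).
    apply Rle_trans with (RInt (fun t => c * exp (- t)) a X).
    - apply RInt_le; [exact HX | apply Hex | eexists; exact E |].
      intros t Ht; apply Hb; lra.
    - rewrite (is_RInt_unique _ _ _ _ E); lra. }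
  destruct (completeness (fun y => exists X, a <= X /\ y = RInt f a X)) as [l [Hub Hlub]].
  { exists (c * exp (- a)); intros y (X & HX & ->); apply Hbound, HX. }
  { exists (RInt f a a), a; split; [lra | reflexivity]. }
  assert (Hlim : is_lim (fun X => RInt f a X) p_infty l).
  { apply is_lim_spec; intro eps.
    destruct (Classical_Prop.classic (exists X, a <= X /\ l - eps < RInt f a X))
      as [(X & HX & Hl) | Hno].
    - exists X; intros Y HY.
      assert (RInt f a X <= RInt f a Y) by (apply Hincr; lra).
      assert (RInt f a Y <= l) by (apply Hub; exists Y; split; [lra | reflexivity]).
      apply Rabs_def1; lra.
    - exfalso.
      assert (l <= l - eps); [|destruct eps; simpl in *; lra].
      apply Hlub; intros y (X & HX & ->).
      apply Rnot_lt_le; intro; apply Hno; exists X; split; assumption. }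
  rewrite (RInt_ray_of_is_lim f a l Hf Hlim); exact Hlim.
Qed.

(** * Gaussian tails and their translates *)

Definition gauss (t : R) : R := exp (- t ^ 2 / 2).

Lemma continuous_gauss (t : R) : continuous gauss t.
Proof. apply continuous_ex_derive; unfold gauss; auto_derive; exact I. Qed.

Lemma ex_RInt_gauss (a b : R) : ex_RInt gauss a b.
Proof. apply ex_RInt_of_continuous, continuous_gauss. Qed.

Lemma is_lim_RInt_gauss (a : R) :
  is_lim (fun X => RInt gauss a X) p_infty (RInt_ray gauss a).
Proof.
  (* From (t-1)^2 >= 0: -t^2/2 <= 1/2 - t. *)
  apply is_lim_RInt_ray with (exp (1 / 2)); [exact continuous_gauss|].
  intros t _; split; [apply Rlt_le, exp_pos|].
  rewrite <- exp_plus; apply exp_le_exp.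
  pose proof (pow2_ge_0 (t - 1)); lra.
Qed.

Lemma is_RInt_gauss_shift (s a b : R) :
  is_RInt (fun t => gauss (t + s)) a b (RInt gauss (a + s) (b + s)).
Proof.
  apply (is_RInt_ext (fun t => scal 1 (gauss (1 * t + s)))).
  { intros t _; change (1 * gauss (1 * t + s) = gauss (t + s)).
    rewrite !Rmult_1_l; reflexivity. }
  apply (is_RInt_comp_lin (V := R_NormedModule)).
  rewrite !Rmult_1_l.
  apply (RInt_correct (V := R_CompleteNormedModule)), ex_RInt_gauss.
Qed.

Lemma is_lim_shift (f : R -> R) (s l : R) :
  is_lim f p_infty l -> is_lim (fun X => f (X + s)) p_infty l.
Proof.
  intro Hf; apply (is_lim_comp f (fun X => X + s) p_infty l p_infty Hf).
  - apply is_lim_spec; intro M; exists (M - s); intros X HX; lra.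
  - exists 0; discriminate.
Qed.

(** Expanding the squares leaves the exponential factor of the Marcum integrand, so comparing
    integrands reduces to comparing sinh with I_0. *)
Lemma gauss_minus_gauss (s t : R) :
  gauss (t + - s) - gauss (t + s) = 2 * exp (- ((t ^ 2 + s ^ 2) / 2)) * sinh (s * t).
Proof.
  unfold sinh, gauss.
  replace (- (t + - s) ^ 2 / 2) with (- ((t ^ 2 + s ^ 2) / 2) + s * t) by field.
  replace (- (t + s) ^ 2 / 2) with (- ((t ^ 2 + s ^ 2) / 2) + - (s * t)) by field.
  rewrite !exp_plus; field.
Qed.

(** * The Marcum Q-function and its lower bound *)

Definition marcum_integrand (alpha t : R) : R :=
  t * exp (- ((t ^ 2 + alpha ^ 2) / 2)) * besselI 0 (alpha * t).

Lemma continuous_marcum_integrand (alpha t : R) : continuous (marcum_integrand alpha) t.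
Proof.
  apply (continuous_mult (K := R_AbsRing)).
  - apply continuous_ex_derive; auto_derive; exact I.
  - apply (continuous_comp (fun t => alpha * t) (besselI 0)); [|apply continuous_besselI0].
    apply continuous_ex_derive; auto_derive; exact I.
Qed.

Lemma is_lim_RInt_marcum (alpha beta : R) :
  0 <= alpha -> 0 <= beta ->
  is_lim (fun X => RInt (marcum_integrand alpha) beta X) p_infty (marcumQ1 alpha beta).
Proof.
  (* Bounding t by exp t and I_0(alpha t) by exp(alpha t) leaves the exponent (1+alpha) t -
     (t^2+alpha^2)/2, which is at most (2+alpha)^2/2 - t because (t-(2+alpha))^2 >= 0. *)
  intros Ha Hb; apply is_lim_RInt_ray with (exp ((2 + alpha) ^ 2 / 2)).
  { apply continuous_marcum_integrand. }
  intros t Ht; unfold marcum_integrand.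
  pose proof (besselI0_ge0 (alpha * t)); pose proof (exp_pos (- ((t ^ 2 + alpha ^ 2) / 2))).
  split; [apply Rmult_le_pos; nra|].
  assert (Hexp : t <= exp t) by (pose proof (exp_ineq1_le t); lra).
  apply Rle_trans with (exp t * exp (- ((t ^ 2 + alpha ^ 2) / 2)) * exp (alpha * t)).
  - apply Rmult_le_compat; [nra | assumption | nra |].
    apply besselI0_le_exp, Rmult_le_pos; lra.
  - rewrite <- !exp_plus; apply exp_le_exp.
    pose proof (pow2_ge_0 (t - (2 + alpha))); pose proof (pow2_ge_0 alpha); nra.
Qed.

Lemma gaussQ_minus (u v : R) :
  gaussQ u - gaussQ v = / sqrt (2 * PI) * (RInt_ray gauss u - RInt_ray gauss v).
Proof. unfold gaussQ; fold gauss; unfold Rdiv; ring. Qed.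

(** Here s stands for the square root of gamma. Translation by alpha = a s in either direction moves
    both Gaussian tails to the ray from beta = b s, where the integrands are compared pointwise
    before X tends to infinity. *)
Lemma marcumQ1_ge (a b s : R) :
  0 < a -> 0 <= b -> 0 <= s ->
  sqrt (b / a) * calK a b (s ^ 2) <= marcumQ1 (a * s) (b * s).
Proof.
  intros Ha Hb Hs; unfold calK.
  replace (sqrt (s ^ 2)) with s by (symmetry; apply sqrt_pow2, Hs).
  replace ((b - a) * s) with (b * s + - (a * s)) by ring.
  replace ((b + a) * s) with (b * s + a * s) by ring.
  rewrite gaussQ_minus.
  set (alpha := a * s); set (beta := b * s).
  assert (Halpha : 0 <= alpha) by (apply Rmult_le_pos; lra).
  assert (Hbeta : 0 <= beta) by (apply Rmult_le_pos; lra).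
  pose proof PI_RGT_0 as Hpi.
  assert (Hpi2 : 0 < sqrt (2 * PI)) by (apply sqrt_lt_R0; lra).
  set (k := sqrt (b / a) * / sqrt (2 * PI)).
  assert (Hk : 0 <= k).
  { apply Rmult_le_pos; [apply sqrt_pos | apply Rlt_le, Rinv_0_lt_compat, Hpi2]. }
  (* k merges delta with the Gaussian normalisation; only its square enters the comparison, which
     removes all roots. *)
  assert (Hk2 : PI * a * (2 * k) ^ 2 = 2 * b).
  { unfold k; rewrite !Rpow_mult_distr, pow_inv, !pow2_sqrt; [field; lra | lra |].
    apply Rdiv_le_0_compat; lra. }
  rewrite <- Rmult_assoc; fold k.
  set (h := fun t => scal k (minus (gauss (t + - alpha)) (gauss (t + alpha)))).
  set (H := fun X => k * (RInt gauss (beta + - alpha) (X + - alpha)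
                          - RInt gauss (beta + alpha) (X + alpha))).
  assert (Hh : forall X, is_RInt h beta X (H X)).
  { intro X; apply (is_RInt_scal (V := R_NormedModule)),
      (is_RInt_minus (V := R_NormedModule)); apply is_RInt_gauss_shift. }
  assert (Hpt : forall t, beta <= t -> h t <= marcum_integrand alpha t).
  { intros t Ht; unfold h, marcum_integrand.
    change (k * (gauss (t + - alpha) - gauss (t + alpha))
            <= t * exp (- ((t ^ 2 + alpha ^ 2) / 2)) * besselI 0 (alpha * t)).
    rewrite gauss_minus_gauss.
    assert (Hat : 0 <= alpha * t) by (apply Rmult_le_pos; lra).
    pose proof (sinh_sqr_le_besselI0_sqr (alpha * t) Hat) as HI.
    pose proof (besselI0_ge0 (alpha * t)) as HI0.
    set (I0 := besselI 0 (alpha * t)) in *; set (S := sinh (alpha * t)) in *.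
    (* After squaring and multiplying by PI a, the left side is 2 b S^2 <= b PI alpha t I0^2. As b
       alpha = a beta, this equals PI a t I0^2 beta, and beta <= t on the ray finishes. *)
    assert (Hmain : 2 * k * S <= t * I0).
    { apply Rsqr_incr_0_var; [|apply Rmult_le_pos; lra].
      unfold Rsqr.
      apply (Rmult_le_reg_l (PI * a)); [nra|].
      replace (PI * a * (2 * k * S * (2 * k * S)))
        with (PI * a * (2 * k) ^ 2 * S ^ 2) by ring.
      rewrite Hk2.
      apply Rle_trans with (b * (PI * (alpha * t) * I0 ^ 2)); [nra|].
      unfold alpha.
      replace (b * (PI * (a * s * t) * I0 ^ 2))
        with (PI * a * t * I0 ^ 2 * beta) by (unfold beta; ring).
      replace (PI * a * (t * I0 * (t * I0))) with (PI * a * t * I0 ^ 2 * t) by ring.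
      apply Rmult_le_compat_l; [|exact Ht].
      assert (0 <= PI * a * t) by (apply Rmult_le_pos; nra).
      pose proof (pow2_ge_0 I0); apply Rmult_le_pos; assumption. }
    pose proof (exp_pos (- ((t ^ 2 + alpha ^ 2) / 2))); nra. }
  apply (is_lim_le_loc H (RInt (marcum_integrand alpha) beta) p_infty
           (k * (RInt_ray gauss (beta + - alpha) - RInt_ray gauss (beta + alpha)))
           (marcumQ1 alpha beta)).
  - exists beta; intros X HX.
    rewrite <- (is_RInt_unique _ _ _ _ (Hh X)).
    apply RInt_le; [lra | eexists; apply Hh | | intros t Ht; apply Hpt; lra].
    apply ex_RInt_of_continuous, continuous_marcum_integrand.
  - apply (is_lim_scal_l _ k p_infty (RInt_ray gauss (beta + - alpha) - RInt_ray gauss (beta + alpha))).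
    apply is_lim_minus'.
    + apply (is_lim_shift (RInt gauss (beta + - alpha))), is_lim_RInt_gauss.
    + apply (is_lim_shift (RInt gauss (beta + alpha))), is_lim_RInt_gauss.
  - apply is_lim_RInt_marcum; assumption.
Qed.

Theorem proposition2 (gamma : R) (hgamma : 0 <= gamma) :
  calH2 gamma >= calL gamma.
Proof.
  (* This makes a positive, so b/a is a true quotient. *)
  assert (Hs : sqrt (1 / 2) < 1) by (rewrite <- sqrt_1 at 2; apply sqrt_lt_1_alt; lra).
  assert (Ha : 0 < dqpsk_a) by (apply sqrt_lt_R0; lra).
  pose proof (marcumQ1_ge dqpsk_a dqpsk_b (sqrt gamma) Ha (sqrt_pos _) (sqrt_pos _)) as H.
  rewrite pow2_sqrt in H by exact hgamma.
  (* The Bessel term is common to both sides and cancels. *)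
  unfold calH2, calL, dqpsk_delta; lra.
Qed.
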